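(* Over $\mathsf{RCA}_0$ the following statements are equivalent: (1) For every countable algebra $\mathcal{A}$ there exists a partial non-principal ultrafilter for $\mathcal{A}$. (2) For every countable algebra $\mathcal{A}$ there exists a partial minimal ultrafilter for $\mathcal{A}$. (3) $\mathsf{ACA}_0$ (arithmetical comprehension).
   Context: A countable algebra $\mathcal{A}=\{A_1,A_2,\dots\}$ is a sequence of subsets of $\mathbb{N}$ closed under finite intersections, unions and complements. A partial non-principal ultrafilter for $\mathcal{A}$ is a subcollection $\mathcal{F}\subseteq\mathcal{A}$ such that: for $X,Y\in\mathcal{A}$, $X\in\mathcal{F}$ and $X\subseteq Y$ imply $Y\in\mathcal{F}$; $X,Y\in\mathcal{F}$ implies $X\cap Y\in\mathcal{F}$; every $X\in\mathcal{F}$ is infinite; and for every $X\in\mathcal{A}$, $X\in\mathcal{F}$ or $\overline{X}=\mathbb{N}\setminus X\in\mathcal{F}$. A partial minimal ultrafilter for $\mathcal{A}$ is a partial non-principal ultrafilter $\mathcal{F}$ for $\mathcal{A}$ such that for every $X\in\mathcal{F}$ the set $\{n\in\mathbb{N}\mid X-n\in\mathcal{F}\}$ is syndetic, where $X-n=\{k\mid k+n\in X\}$ and a set $S\subseteq\mathbb{N}$ is syndetic if there is $m$ such that $S\cap[x,x+m]\ne\emptyset$ for all $x$.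
   Formalization: In (2) the countable algebras are also required to be closed under X ↦ X − n; without this (2) is false, e.g. for the algebra {∅, X, complement of X, ℕ} with X the set of squares. *)

(* Defs.v *)
Set Implicit Arguments.
Unset Strict Implicit.

(* Structures for the language of second-order arithmetic. The first-order part
   may be nonstandard, and the second-order part need not contain all subsets;
   [set_ext] makes an element of [set] nothing more than a subset of [num]. *)
Record L2_structure := {
  num : Type;
  set : Type;
  zero : num;
  one : num;
  add : num -> num -> num;
  mul : num -> num -> num;
  lt : num -> num -> Prop;
  mem : num -> set -> Prop;
  set_ext : forall X Y : set, (forall n, mem n X <-> mem n Y) -> X = Y
}.

Arguments zero {l}.
Arguments one {l}.
Arguments add {l} _ _.
Arguments mul {l} _ _.
Arguments lt {l} _ _.
Arguments mem {l} _ _.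

Declare Scope L2_scope.
Delimit Scope L2_scope with L2.
Notation "0" := zero : L2_scope.
Notation "1" := one : L2_scope.
Notation "x + y" := (add x y) : L2_scope.
Notation "x * y" := (mul x y) : L2_scope.
Notation "x < y" := (lt x y) : L2_scope.
Notation "x <= y" := (lt x y \/ x = y) : L2_scope.
Notation "n ∈ X" := (mem n X) (at level 70, no associativity) : L2_scope.
Local Open Scope L2_scope.

(* Arithmetical formulas: number variables are de Bruijn indices, and there are
   no set quantifiers, so every set variable is a parameter. *)
Inductive term :=
| Var (n : nat)
| Zero
| One
| Add (s t : term)
| Mul (s t : term).

Inductive formula :=
| Eq (s t : term)
| Lt (s t : term)
| Mem (t : term) (X : nat)
| Not (p : formula)
| And (p q : formula)
| Or (p q : formula)
| Imp (p q : formula)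
| All (p : formula)
| Ex (p : formula).

Fixpoint lift (t : term) : term :=
  match t with
  | Var n => Var (S n)
  | Zero => Zero
  | One => One
  | Add s t => Add (lift s) (lift t)
  | Mul s t => Mul (lift s) (lift t)
  end.

Definition push (T : Type) (a : T) (e : nat -> T) (n : nat) : T :=
  match n with O => a | S m => e m end.

Fixpoint eval (M : L2_structure) (e : nat -> num M) (t : term) : num M :=
  match t with
  | Var n => e n
  | Zero => 0
  | One => 1
  | Add s t => eval e s + eval e t
  | Mul s t => eval e s * eval e t
  end.

Fixpoint sat (M : L2_structure) (e : nat -> num M) (v : nat -> set M)
    (p : formula) : Prop :=
  match p with
  | Eq s t => eval e s = eval e t
  | Lt s t => eval e s < eval e t
  | Mem t X => eval e t ∈ v X
  | Not p => ~ sat e v p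
  | And p q => sat e v p /\ sat e v q
  | Or p q => sat e v p \/ sat e v q
  | Imp p q => sat e v p -> sat e v q
  | All p => forall a, sat (push a e) v p
  | Ex p => exists a, sat (push a e) v p
  end.

(* Bounded quantifier formulas: [lift t] says that the bound does not mention
   the quantified variable. *)
Inductive Sigma00 : formula -> Prop :=
| Sigma00_Eq s t : Sigma00 (Eq s t)
| Sigma00_Lt s t : Sigma00 (Lt s t)
| Sigma00_Mem t X : Sigma00 (Mem t X)
| Sigma00_Not p : Sigma00 p -> Sigma00 (Not p)
| Sigma00_And p q : Sigma00 p -> Sigma00 q -> Sigma00 (And p q)
| Sigma00_Or p q : Sigma00 p -> Sigma00 q -> Sigma00 (Or p q)
| Sigma00_Imp p q : Sigma00 p -> Sigma00 q -> Sigma00 (Imp p q)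
| Sigma00_All t p : Sigma00 p -> Sigma00 (All (Imp (Lt (Var O) (lift t)) p))
| Sigma00_Ex t p : Sigma00 p -> Sigma00 (Ex (And (Lt (Var O) (lift t)) p)).

Inductive Sigma01 : formula -> Prop :=
| Sigma01_Ex p : Sigma00 p -> Sigma01 (Ex p).

Inductive Pi01 : formula -> Prop :=
| Pi01_All p : Sigma00 p -> Pi01 (All p).

Record basic_axioms (M : L2_structure) : Prop := {
  succ_neq0 : forall n : num M, n + 1 <> 0;
  succ_inj : forall m n : num M, m + 1 = n + 1 -> m = n;
  add_0 : forall m : num M, m + 0 = m;
  add_succ : forall m n : num M, m + (n + 1) = (m + n) + 1;
  mul_0 : forall m : num M, m * 0 = 0;
  mul_succ : forall m n : num M, m * (n + 1) = m * n + m;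
  not_lt0 : forall m : num M, ~ m < 0;
  lt_succ : forall m n : num M, m < n + 1 <-> m <= n
}.

(* In the schemes, variable 0 is the distinguished number variable; the
   assignments [e] and [v] supply the number and set parameters. *)
Definition Sigma01_induction (M : L2_structure) : Prop :=
  forall p, Sigma01 p -> forall (e : nat -> num M) (v : nat -> set M),
  sat (push 0 e) v p ->
  (forall n, sat (push n e) v p -> sat (push (n + 1) e) v p) ->
  forall n, sat (push n e) v p.

Definition Delta01_comprehension (M : L2_structure) : Prop :=
  forall p q, Sigma01 p -> Pi01 q ->
  forall (e : nat -> num M) (v : nat -> set M),
  (forall n, sat (push n e) v p <-> sat (push n e) v q) ->
  exists X, forall n, n ∈ X <-> sat (push n e) v p.

Definition arithmetical_comprehension (M : L2_structure) : Prop :=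
  forall p (e : nat -> num M) (v : nat -> set M),
  exists X, forall n, n ∈ X <-> sat (push n e) v p.

Record RCA0 (M : L2_structure) : Prop := {
  RCA0_basic : basic_axioms M;
  RCA0_induction : Sigma01_induction M;
  RCA0_comprehension : Delta01_comprehension M
}.

(* A predicate [P : num M -> Prop] below always abbreviates a formula; it does
   not have to be the extension of an element of [set M]. *)

Definition finite (M : L2_structure) (P : num M -> Prop) : Prop :=
  exists k, forall i, P i -> i < k.

Definition infinite (M : L2_structure) (P : num M -> Prop) : Prop :=
  ~ finite P.

Definition syndetic (M : L2_structure) (P : num M -> Prop) : Prop :=
  exists m, forall x, exists y, P y /\ x <= y /\ y <= x + m.

Definition pair (M : L2_structure) (i x : num M) : num M :=
  (i + x) * (i + x) + i.

(* A sequence of sets is a set of pairs; [at_index A i] is its member [A_i]. *)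
Definition at_index (M : L2_structure) (A : set M) (i x : num M) : Prop :=
  pair i x ∈ A.

Definition in_seq (M : L2_structure) (A : set M) (P : num M -> Prop) : Prop :=
  exists k, forall x, at_index A k x <-> P x.

(* [D] ranges over the finite sets of indices in the sense of [M], so the
   finite unions and intersections may have nonstandard length. *)
Record countable_algebra (M : L2_structure) (A : set M) : Prop := {
  algebra_inter : forall D : set M, finite (fun i => i ∈ D) ->
    in_seq A (fun x => forall i, i ∈ D -> at_index A i x);
  algebra_union : forall D : set M, finite (fun i => i ∈ D) ->
    in_seq A (fun x => exists i, i ∈ D /\ at_index A i x);
  algebra_compl : forall i : num M, in_seq A (fun x => ~ at_index A i x)
}.

Definition translation_closed (M : L2_structure) (A : set M) : Prop :=
  forall i n : num M, in_seq A (fun x => at_index A i (x + n)).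

(* A subcollection of [A] is given by a set [F] of indices; [in_subcoll A F P]
   says that the set defined by [P] is one of the [A_k] with [k] in [F]. *)
Definition in_subcoll (M : L2_structure) (A F : set M) (P : num M -> Prop) :
    Prop :=
  exists k, k ∈ F /\ forall x, at_index A k x <-> P x.

Record partial_nonprincipal_ultrafilter (M : L2_structure) (A F : set M) :
    Prop := {
  filter_up : forall i j : num M, i ∈ F ->
    (forall x, at_index A i x -> at_index A j x) -> j ∈ F;
  filter_inter : forall i j : num M, i ∈ F -> j ∈ F ->
    in_subcoll A F (fun x => at_index A i x /\ at_index A j x);
  filter_infinite : forall i : num M, i ∈ F -> infinite (at_index A i);
  filter_ultra : forall i : num M,
    i ∈ F \/ in_subcoll A F (fun x => ~ at_index A i x)
}.

Record partial_minimal_ultrafilter (M : L2_structure) (A F : set M) : Prop := {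
  minimal_ultrafilter : partial_nonprincipal_ultrafilter A F;
  minimal_syndetic : forall i : num M, i ∈ F ->
    syndetic (fun n => in_subcoll A F (fun k => at_index A i (k + n)))
}.

Definition partial_nonprincipal_ultrafilters_exist (M : L2_structure) : Prop :=
  forall A : set M, countable_algebra A ->
  exists F : set M, partial_nonprincipal_ultrafilter A F.

(* The condition [X - n ∈ F] presupposes that [F] decides [X - n], that is,
   [X - n ∈ A]. Without [translation_closed] the assertion is refutable: if [X]
   is the set of squares, no partial ultrafilter for the algebra
   {∅, X, complement of X, ℕ} is minimal, since there [X - n] and its
   complement are not in the algebra for any n > 0. *)
Definition partial_minimal_ultrafilters_exist (M : L2_structure) : Prop :=
  forall A : set M, countable_algebra A -> translation_closed A ->
  exists F : set M, partial_minimal_ultrafilter A F.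

(* Main.v *)
(** Reversal: given a set [Y], let [A_n] consist of the [x] such that no [m < x]
    satisfies [pair m n ∈ Y]. It is an initial segment, and it is everything unless
    [n] belongs to the projection of [Y], in which case it is finite. Hence the
    projection can be read off any nonprincipal ultrafilter for the translation
    closed algebra of the finite sets, the cofinite sets and the [A_n].

    Construction: arithmetical comprehension allows a greedy choice of an ultrafilter.
    For minimality one first chooses a maximal set [J] of indices such that the
    complements of the [A_j], [j] in [J], have thick finite intersections, and then an
    ultrafilter [F] containing every translate of these complements. If [A_i] is in [F]
    then [i] is not in [J], so by maximality some finite union of [A_i] with sets [A_j],
    [j] in [J], meets every interval of some length [m]; since [F] contains no translate
    of the [A_j], it contains a translate of [A_i] for some number in every such
    interval. *)

From Stdlib Require Import Arith Lia Classical Ring.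
Require Import Defs.
Set Implicit Arguments.
Unset Strict Implicit.
Local Open Scope L2_scope.

(** * Bounded formulas with parameters *)

Definition up (r : nat -> nat) (n : nat) : nat :=
  match n with O => O | S m => S (r m) end.

Fixpoint trename (r : nat -> nat) (t : term) : term :=
  match t with
  | Var n => Var (r n)
  | Zero => Zero
  | One => One
  | Add s t => Add (trename r s) (trename r t)
  | Mul s t => Mul (trename r s) (trename r t)
  end.

Fixpoint frename (r s : nat -> nat) (p : formula) : formula :=
  match p with
  | Eq a b => Eq (trename r a) (trename r b)
  | Lt a b => Lt (trename r a) (trename r b)
  | Mem a X => Mem (trename r a) (s X)
  | Not p => Not (frename r s p)
  | And p q => And (frename r s p) (frename r s q)
  | Or p q => Or (frename r s p) (frename r s q)
  | Imp p q => Imp (frename r s p) (frename r s q)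
  | All p => All (frename (up r) s p)
  | Ex p => Ex (frename (up r) s p)
  end.

Lemma trename_lift r t : trename (up r) (lift t) = lift (trename r t).
Proof. induction t; simpl; congruence. Qed.

Lemma Sigma00_frename p : Sigma00 p -> forall r s, Sigma00 (frename r s p).
Proof.
  induction 1; intros r s'; simpl; rewrite ?trename_lift; constructor; auto.
Qed.

Section Model.
Context (M : L2_structure).
Implicit Types (e : nat -> num M).

Lemma eval_trename r e e' t :
  (forall n, e (r n) = e' n) -> eval e (trename r t) = eval e' t.
Proof. intros H; induction t; simpl; congruence. Qed.

Lemma eval_lift a e t : eval (push a e) (lift t) = eval e t.
Proof. induction t; simpl; congruence. Qed.

Lemma sat_frename p : forall r s e e' v v',
  (forall n, e (r n) = e' n) -> (forall n, v (s n) = v' n) ->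
  (sat e v (frename r s p) <-> sat e' v' p).
Proof.
  induction p; intros r s0 e e' v v' He Hv; simpl;
    rewrite ?(eval_trename _ He), ?Hv; try tauto.
  - rewrite (IHp _ _ _ _ _ _ He Hv); tauto.
  - rewrite (IHp1 _ _ _ _ _ _ He Hv), (IHp2 _ _ _ _ _ _ He Hv); tauto.
  - rewrite (IHp1 _ _ _ _ _ _ He Hv), (IHp2 _ _ _ _ _ _ He Hv); tauto.
  - rewrite (IHp1 _ _ _ _ _ _ He Hv), (IHp2 _ _ _ _ _ _ He Hv); tauto.
  - split; intros H a; specialize (H a); revert H;
      (rewrite (IHp (up r) s0 (push a e) (push a e') v v'); [auto | | auto]);
      intros [|n]; simpl; auto.
  - split; intros [a H]; exists a; revert H;
      (rewrite (IHp (up r) s0 (push a e) (push a e') v v'); [auto | | auto]);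
      intros [|n]; simpl; auto.
Qed.

Lemma sat_ext p e e' v v' :
  (forall n, e n = e' n) -> (forall n, v n = v' n) -> (sat e v p <-> sat e' v' p).
Proof.
  intros He Hv.
  rewrite <- (@sat_frename p (fun n => n) (fun n => n) e e v v) by auto.
  apply sat_frename; auto.
Qed.

(** * Environments split into live variables and parameters *)

Fixpoint cat (k : nat) e (c : nat -> num M) : nat -> num M :=
  match k with
  | O => c
  | S k => push (e O) (cat k (fun i => e (S i)) c)
  end.

Lemma cat_lt k : forall e c i, (i < k)%nat -> cat k e c i = e i.
Proof.
  induction k as [|k IH]; intros e c [|i] H; simpl; try lia; auto.
  rewrite IH by lia; auto.
Qed.

Lemma cat_ge k : forall e c i, cat k e c (k + i)%nat = c i.
Proof. induction k as [|k IH]; intros e c i; simpl; auto. Qed.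

(** Live variables and parameters are renamed independently, so parameter lists can be merged
    without disturbing the variables. *)
Definition ren (k k' : nat) (r s : nat -> nat) (i : nat) : nat :=
  if (i <? k)%nat then r i else (k' + s (i - k))%nat.

Lemma cat_ren k k' r s e e' c c' :
  (forall i, (i < k)%nat -> (r i < k')%nat) ->
  (forall i, (i < k)%nat -> e (r i) = e' i) -> (forall i, c (s i) = c' i) ->
  forall i, cat k' e c (ren k k' r s i) = cat k e' c' i.
Proof.
  intros Hr He Hc i; unfold ren; destruct (Nat.ltb_spec i k) as [H|H].
  - rewrite !cat_lt; auto.
  - rewrite cat_ge, Hc. replace i with (k + (i - k))%nat at 2 by lia.
    rewrite cat_ge; auto.
Qed.

(** Interleaving joins the parameters of two formulas into one sequence, so that both can occur in a
    single formula. *)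
Definition mix (U : Type) (f g : nat -> U) (n : nat) : U :=
  if Nat.even n then f (Nat.div2 n) else g (Nat.div2 n).

Definition even_slot (n : nat) : nat := (2 * n)%nat.
Definition odd_slot (n : nat) : nat := S (2 * n)%nat.

Lemma mix_even (U : Type) (f g : nat -> U) n : mix f g (even_slot n) = f n.
Proof.
  unfold mix, even_slot. rewrite Nat.even_even, Nat.div2_double; auto.
Qed.

Lemma mix_odd (U : Type) (f g : nat -> U) n : mix f g (odd_slot n) = g n.
Proof.
  unfold mix, odd_slot. replace (S (2 * n)) with (2 * n + 1)%nat by lia.
  rewrite Nat.even_odd. replace (2 * n + 1)%nat with (S (2 * n)) by lia.
  rewrite Nat.div2_succ_double; auto.
Qed.

(* Predicates and functions of the first [k] entries of the environment that are
   given by a bounded formula, resp. a term, with parameters from [M]. *)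
Definition Poly (k : nat) (f : (nat -> num M) -> num M) : Prop :=
  exists t c, forall e, f e = eval (cat k e c) t.

Definition Delta0 (k : nat) (P : (nat -> num M) -> Prop) : Prop :=
  exists p v c, Sigma00 p /\ forall e, P e <-> sat (cat k e c) v p.

Lemma Poly_merge k f l g : Poly k f -> Poly l g -> exists t s c,
  (forall e, f e = eval (cat k e c) t) /\ (forall e, g e = eval (cat l e c) s).
Proof.
  intros (t & c & H) (s & d & H').
  exists (trename (ren k k (fun i => i) even_slot) t),
    (trename (ren l l (fun i => i) odd_slot) s),
    (mix c d).
  split; intros e; rewrite ?H, ?H'; symmetry; apply eval_trename; apply cat_ren;
    auto using mix_even, mix_odd.
Qed.

Lemma Poly_Delta0_merge k f l P : Poly k f -> Delta0 l P -> exists t p v c, Sigma00 p /\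
  (forall e, f e = eval (cat k e c) t) /\ (forall e, P e <-> sat (cat l e c) v p).
Proof.
  intros (t & c & H) (p & v & d & S & H').
  exists (trename (ren k k (fun i => i) even_slot) t),
    (frename (ren l l (fun i => i) odd_slot) (fun i => i) p), v, (mix c d).
  split; [apply Sigma00_frename; auto|].
  split; intros e; [rewrite H|rewrite H'].
  - symmetry; apply eval_trename; apply cat_ren; auto using mix_even.
  - symmetry; apply sat_frename; auto; apply cat_ren; auto using mix_odd.
Qed.

Lemma Delta0_merge k P l Q : Delta0 k P -> Delta0 l Q ->
  exists p q v c, Sigma00 p /\ Sigma00 q /\
  (forall e, P e <-> sat (cat k e c) v p) /\ (forall e, Q e <-> sat (cat l e c) v q).
Proof.
  intros (p & v & c & S & H) (q & v' & d & S' & H').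
  exists (frename (ren k k (fun i => i) even_slot) even_slot p),
    (frename (ren l l (fun i => i) odd_slot) odd_slot q), (mix v v'), (mix c d).
  split; [apply Sigma00_frename; auto|].
  split; [apply Sigma00_frename; auto|].
  split; intros e; [rewrite H|rewrite H']; symmetry; apply sat_frename;
    auto using mix_even, mix_odd; apply cat_ren; auto using mix_even, mix_odd.
Qed.

Lemma Poly_var k i : (i < k)%nat -> Poly k (fun e => e i).
Proof. intros H; exists (Var i), (fun _ => 0); intros e; simpl; rewrite cat_lt; auto. Qed.

Lemma Poly_const k a : Poly k (fun _ => a).
Proof. exists (Var (k + 0)), (fun _ => a); intros e; simpl. rewrite cat_ge; auto. Qed.

Lemma Poly_add k f g : Poly k f -> Poly k g -> Poly k (fun e => f e + g e).
Proof.
  intros Hf Hg; destruct (Poly_merge Hf Hg) as (t & s & c & H & H').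
  exists (Add t s), c; intros e; simpl; congruence.
Qed.

Lemma Poly_mul k f g : Poly k f -> Poly k g -> Poly k (fun e => f e * g e).
Proof.
  intros Hf Hg; destruct (Poly_merge Hf Hg) as (t & s & c & H & H').
  exists (Mul t s), c; intros e; simpl; congruence.
Qed.

Lemma Delta0_iff k P Q : Delta0 k P -> (forall e, Q e <-> P e) -> Delta0 k Q.
Proof.
  intros (p & v & c & S & H) H'; exists p, v, c; split; auto.
  intros e; rewrite H'; auto.
Qed.

(* [Eq] and [Lt] have no set variables, but [sat] still asks for a set valuation. *)
Context (hM : RCA0 M) (X0 : set M).

Lemma Delta0_eq k f g : Poly k f -> Poly k g -> Delta0 k (fun e => f e = g e).
Proof.
  intros Hf Hg; destruct (Poly_merge Hf Hg) as (t & s & c & H & H').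
  exists (Eq t s), (fun _ => X0), c; split; [constructor|]; intros e; simpl.
  rewrite H, H'; tauto.
Qed.

Lemma Delta0_lt k f g : Poly k f -> Poly k g -> Delta0 k (fun e => f e < g e).
Proof.
  intros Hf Hg; destruct (Poly_merge Hf Hg) as (t & s & c & H & H').
  exists (Lt t s), (fun _ => X0), c; split; [constructor|]; intros e; simpl.
  rewrite H, H'; tauto.
Qed.

Lemma Delta0_mem k f X : Poly k f -> Delta0 k (fun e => f e ∈ X).
Proof.
  intros (t & c & H); exists (Mem t O), (fun _ => X), c; split; [constructor|].
  intros e; simpl; rewrite H; tauto.
Qed.

Lemma Delta0_not k P : Delta0 k P -> Delta0 k (fun e => ~ P e).
Proof.
  intros (p & v & c & S & H); exists (Not p), v, c; split; [constructor; auto|].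
  intros e; simpl; rewrite H; tauto.
Qed.

Lemma Delta0_and k P Q : Delta0 k P -> Delta0 k Q -> Delta0 k (fun e => P e /\ Q e).
Proof.
  intros HP HQ; destruct (Delta0_merge HP HQ) as (p & q & v & c & S & S' & H & H').
  exists (And p q), v, c; split; [constructor; auto|].
  intros e; simpl; rewrite H, H'; tauto.
Qed.

Lemma Delta0_or k P Q : Delta0 k P -> Delta0 k Q -> Delta0 k (fun e => P e \/ Q e).
Proof.
  intros HP HQ; destruct (Delta0_merge HP HQ) as (p & q & v & c & S & S' & H & H').
  exists (Or p q), v, c; split; [constructor; auto|].
  intros e; simpl; rewrite H, H'; tauto.
Qed.

Lemma Delta0_imp k P Q : Delta0 k P -> Delta0 k Q -> Delta0 k (fun e => P e -> Q e).
Proof.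
  intros HP HQ; apply Delta0_iff with (fun e => ~ P e \/ Q e).
  - apply Delta0_or; [apply Delta0_not|]; auto.
  - intros e; split; [intros H|tauto].
    destruct (classic (P e)); auto.
Qed.

Lemma Delta0_all k f (Q : num M -> (nat -> num M) -> Prop) :
  Poly k f -> Delta0 (S k) (fun e => Q (e O) (fun i => e (S i))) ->
  Delta0 k (fun e => forall y, y < f e -> Q y e).
Proof.
  intros Hf HQ; destruct (Poly_Delta0_merge Hf HQ) as (t & p & v & c & S & H & H').
  exists (All (Imp (Lt (Var O) (lift t)) p)), v, c; split; [constructor; auto|].
  intros e; simpl; split; intros G y L.
  (* [cat (S k) (push y e) c] is convertible with [push y (cat k e c)], so the same parameters serve
     under the quantifier. *)
  - rewrite eval_lift, <- H in L. apply (H' (push y e)), G, L.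
  - apply (H' (push y e)), G. rewrite eval_lift, <- H; auto.
Qed.

Lemma Delta0_ex k f (Q : num M -> (nat -> num M) -> Prop) :
  Poly k f -> Delta0 (S k) (fun e => Q (e O) (fun i => e (S i))) ->
  Delta0 k (fun e => exists y, y < f e /\ Q y e).
Proof.
  intros Hf HQ; destruct (Poly_Delta0_merge Hf HQ) as (t & p & v & c & S & H & H').
  exists (Ex (And (Lt (Var O) (lift t)) p)), v, c; split; [constructor; auto|].
  intros e; simpl; split; intros (y & L & G); exists y; split;
    rewrite ?eval_lift, <- ?H in *; auto; apply (H' (push y e)); auto.
Qed.

Lemma Delta0_all_le k f (Q : num M -> (nat -> num M) -> Prop) :
  Poly k f -> Delta0 (S k) (fun e => Q (e O) (fun i => e (S i))) ->
  Delta0 k (fun e => forall y, y <= f e -> Q y e).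
Proof.
  intros Hf HQ; apply Delta0_iff with (fun e => forall y, y < f e + 1 -> Q y e).
  - apply (Delta0_all (Poly_add Hf (Poly_const k 1)) HQ).
  - intros e; split; intros H y L; apply H; apply (lt_succ (RCA0_basic hM)); auto.
Qed.

Lemma Delta0_ex_le k f (Q : num M -> (nat -> num M) -> Prop) :
  Poly k f -> Delta0 (S k) (fun e => Q (e O) (fun i => e (S i))) ->
  Delta0 k (fun e => exists y, y <= f e /\ Q y e).
Proof.
  intros Hf HQ; apply Delta0_iff with (fun e => exists y, y < f e + 1 /\ Q y e).
  - apply (Delta0_ex (Poly_add Hf (Poly_const k 1)) HQ).
  - intros e; split; intros (y & L & H); exists y; split; auto;
      apply (lt_succ (RCA0_basic hM)); auto.
Qed.

Lemma Delta0_sub k k' P r (h : (nat -> num M) -> nat -> num M) :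
  Delta0 k P -> (forall i, (i < k)%nat -> (r i < k')%nat) ->
  (forall e i, (i < k)%nat -> e (r i) = h e i) ->
  Delta0 k' (fun e => P (h e)).
Proof.
  intros (p & v & c & S & H) Hr He.
  exists (frename (ren k k' r (fun i => i)) (fun i => i) p), v, c.
  split; [apply Sigma00_frename; auto|]. intros e; rewrite H.
  symmetry; apply sat_frename; auto. apply cat_ren; auto.
Qed.

Lemma Poly_shift k f : Poly k f -> Poly (S k) (fun e => f (fun i => e (S i))).
Proof.
  intros (t & c & H); exists (trename S t), c; intros e; rewrite H.
  symmetry; apply eval_trename; auto.
Qed.

(** A quantifier bounded by the value of [f] does the work of substituting a term into a formula. *)
Lemma Delta0_let k f (Q : num M -> (nat -> num M) -> Prop) :
  Poly k f -> Delta0 (S k) (fun e => Q (e O) (fun i => e (S i))) ->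
  Delta0 k (fun e => Q (f e) e).
Proof.
  intros Hf HQ.
  apply Delta0_iff with (fun e => exists x, x <= f e /\ x = f e /\ Q x e).
  - apply Delta0_ex_le; auto. apply Delta0_and; auto.
    apply Delta0_eq; [apply Poly_var; lia|apply Poly_shift; auto].
  - intros e; split; [eauto|]. intros (x & _ & -> & H); auto.
Qed.

Lemma Delta0_app1 k (P : num M -> Prop) f :
  Delta0 1 (fun e => P (e O)) -> Poly k f -> Delta0 k (fun e => P (f e)).
Proof.
  intros H Hf; apply (Delta0_let (Q := fun x _ => P x) Hf).
  apply (@Delta0_sub 1 (S k) (fun e => P (e O)) (fun i => i) (fun e => e)); auto.
  intros i; lia.
Qed.

Lemma Delta0_app2 k (P : num M -> num M -> Prop) f g :
  Delta0 2 (fun e => P (e O) (e 1%nat)) -> Poly k f -> Poly k g ->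
  Delta0 k (fun e => P (f e) (g e)).
Proof.
  intros H Hf Hg; apply (Delta0_let (Q := fun x e => P x (g e)) Hf).
  apply (Delta0_let (Q := fun y e => P (e O) y) (Poly_shift Hg)).
  (* The variable bound last has index 0, so the arguments appear in reverse order. *)
  apply (@Delta0_sub 2 (S (S k)) (fun e => P (e O) (e 1%nat))
    (fun i => match i with O => 1 | _ => 0 end)%nat
    (fun e i => e (match i with O => 1 | _ => 0 end)%nat)); auto.
  intros [|i]; lia.
Qed.

Lemma Delta0_app3 k (P : num M -> num M -> num M -> Prop) f g h :
  Delta0 3 (fun e => P (e O) (e 1%nat) (e 2%nat)) -> Poly k f -> Poly k g -> Poly k h ->
  Delta0 k (fun e => P (f e) (g e) (h e)).
Proof.
  intros H Hf Hg Hh; apply (Delta0_let (Q := fun x e => P x (g e) (h e)) Hf).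
  apply (Delta0_let (Q := fun y e => P (e O) y (h (fun i => e (S i)))) (Poly_shift Hg)).
  apply (Delta0_let (Q := fun z e => P (e 1%nat) (e O) z) (Poly_shift (Poly_shift Hh))).
  apply (@Delta0_sub 3 (S (S (S k))) (fun e => P (e O) (e 1%nat) (e 2%nat))
    (fun i => match i with O => 2 | 1 => 1 | _ => 0 end)%nat
    (fun e i => e (match i with O => 2 | 1 => 1 | _ => 0 end)%nat)); auto.
  intros [|[|i]]; lia.
Qed.

Lemma Delta0_env k P e e' :
  Delta0 k P -> (forall i, (i < k)%nat -> e i = e' i) -> P e <-> P e'.
Proof.
  intros (p & v & c & S & H) He; rewrite !H; apply sat_ext; auto.
  intros i; destruct (Nat.lt_ge_cases i k).
  - rewrite !cat_lt; auto.
  - replace i with (k + (i - k))%nat by lia; rewrite !cat_ge; auto.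
Qed.

(** * Induction and comprehension for definable predicates *)

Lemma sigma_induction (Q : num M -> num M -> Prop) :
  Delta0 2 (fun e => Q (e O) (e 1%nat)) -> (exists y, Q y 0) ->
  (forall n y, Q y n -> exists z, Q z (n + 1)) -> forall n, exists y, Q y n.
Proof.
  intros (p & v & c & S & H) H0 H1 n.
  pose proof (@RCA0_induction M hM (Ex p) (Sigma01_Ex S) c v) as I; simpl in I.
  assert (E : forall n y, sat (push y (push n c)) v p <-> Q y n).
  { intros m y; symmetry; exact (H (push y (push m c))). }
  destruct (I) with (n := n) as [y Hy].
  - destruct H0 as [y Hy]; exists y; apply E; auto.
  - intros m [y Hy]; destruct (H1 m y) as [z Hz]; [apply E; auto|].
    exists z; apply E; auto.
  - exists y; apply E; auto.
Qed.

Lemma induction (P : num M -> Prop) :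
  Delta0 1 (fun e => P (e O)) -> P 0 -> (forall n, P n -> P (n + 1)) -> forall n, P n.
Proof.
  intros HP H0 H1 n.
  destruct (@sigma_induction (fun _ n => P n)) with (n := n); auto.
  - apply (Delta0_app1 HP), Poly_var; auto.
  - exists 0; auto.
  - intros m _ Hm; exists 0; auto.
Qed.

Lemma comprehension (P : num M -> Prop) :
  Delta0 1 (fun e => P (e O)) -> exists X, forall n, n ∈ X <-> P n.
Proof.
  intros (p & v & c & S & H).
  (* The shift makes room for a dummy quantifier: [Ex q] and [All q] then express the same predicate
     in Sigma01 and in Pi01 form. *)
  set (q := frename (fun i => i + 1)%nat (fun i => i) p).
  assert (E : forall n y, sat (push y (push n c)) v q <-> P n).
  { intros n y; unfold q; rewrite (@sat_frename p _ _ _ (push n c) _ v); auto.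
    - symmetry; exact (H (push n c)).
    - intros i; rewrite Nat.add_1_r; auto. }
  assert (Sq : Sigma00 q) by (apply Sigma00_frename; auto).
  destruct (@RCA0_comprehension M hM (Ex q) (All q) (Sigma01_Ex Sq) (Pi01_All Sq) c v)
    as [X HX]; simpl in *.
  - intros n; split.
    + intros [y Hy] z; apply E in Hy; apply E; auto.
    + intros Hy; exists 0; auto.
  - exists X; intros n; rewrite HX; split.
    + intros [y Hy]; apply E in Hy; auto.
    + intros Hn; exists 0; apply E; auto.
Qed.

(* Redefined below for structures where unbounded quantifiers can be eliminated. *)
Ltac definable_unbounded := fail.

(** Recursion on the shape of the predicate. Bounded quantifiers are tried before implications and
    unbounded quantifiers; abstract predicates are matched with definability hypotheses, and
    anything else is left as a goal. *)
Ltac definable :=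
  unfold at_index, pair; cbn beta;
  lazymatch goal with
  | |- Poly _ (fun _ => ?a) => apply Poly_const
  | |- Poly _ (fun e => _ + _) => apply Poly_add; definable
  | |- Poly _ (fun e => _ * _) => apply Poly_mul; definable
  | |- Poly _ (fun e => e _) => apply Poly_var; lia
  | |- forall _, _ => intros; definable
  | |- Delta0 _ (fun e => _ /\ _) => apply Delta0_and; definable
  | |- Delta0 _ (fun e => _ <-> _) => apply Delta0_and; definable
  | |- Delta0 _ (fun e => _ \/ _) => apply Delta0_or; definable
  | |- Delta0 _ (fun e => ~ _) => apply Delta0_not; definable
  | |- Delta0 _ (fun e => _ ∈ _) => apply Delta0_mem; definable
  | |- Delta0 _ (fun e => _ = _) => apply Delta0_eq; definable
  | |- Delta0 _ (fun e => _ < _) => apply Delta0_lt; definable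
  | |- Delta0 _ (fun e => forall y, y < _ -> _) => apply Delta0_all; definable
  | |- Delta0 _ (fun e => forall y, y <= _ -> _) => apply Delta0_all_le; definable
  | |- Delta0 _ (fun e => exists y, y < _ /\ _) => apply Delta0_ex; definable
  | |- Delta0 _ (fun e => exists y, y <= _ /\ _) => apply Delta0_ex_le; definable
  | |- Delta0 _ (fun e => @?P e -> @?Q e) => apply (@Delta0_imp _ P Q); definable
  | |- Delta0 _ _ =>
    first [ assumption
          | match goal with
            | |- Delta0 _ (fun e => ?P (@?f e)) =>
                apply (@Delta0_app1 _ P f); [assumption|]; definable
            | |- Delta0 _ (fun e => ?P (@?f e) (@?g e)) =>
                apply (@Delta0_app2 _ P f g); [assumption| |]; definable
            | |- Delta0 _ (fun e => ?P (@?f e) (@?g e) (@?h e)) =>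
                apply (@Delta0_app3 _ P f g h); [assumption| | |]; definable
            end
          | definable_unbounded
          | idtac ]
  end.

Ltac induct n :=
  revert n;
  match goal with |- forall x, @?P x => apply (@induction P) end;
  cbn beta; [definable| |].

(** * Arithmetic in a model of RCA0 *)

Implicit Types (x y z a b c d m n q u v w : num M) (X Y Z F : set M).

Let ax := RCA0_basic hM.

Lemma add0 m : m + 0 = m. Proof. exact (add_0 ax m). Qed.
Lemma addS m n : m + (n + 1) = m + n + 1. Proof. exact (add_succ ax m n). Qed.
Lemma mul0 m : m * 0 = 0. Proof. exact (mul_0 ax m). Qed.
Lemma mulS m n : m * (n + 1) = m * n + m. Proof. exact (mul_succ ax m n). Qed.

Lemma addA m n k : m + (n + k) = m + n + k.
Proof.
  induct k; [now rewrite !add0|].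
  intros k IH; rewrite !addS, IH; auto.
Qed.

Lemma add0l n : 0 + n = n.
Proof.
  induct n; [apply add0|]. intros n IH; rewrite addS, IH; auto.
Qed.

Lemma add1l n : 1 + n = n + 1.
Proof.
  induct n; [rewrite add0, add0l; auto|]. intros n IH; rewrite addS, IH; auto.
Qed.

Lemma addC m n : m + n = n + m.
Proof.
  induct n; [rewrite add0, add0l; auto|]. intros n IH.
  rewrite addS, IH, <- !addA, add1l; auto.
Qed.

Lemma mul0l n : 0 * n = 0.
Proof.
  induct n; [apply mul0|]. intros n IH; rewrite mulS, IH, add0; auto.
Qed.

Lemma mulDr m n k : m * (n + k) = m * n + m * k.
Proof.
  induct k; [rewrite mul0, !add0; auto|].
  intros k IH; rewrite addS, !mulS, IH, addA; auto.
Qed.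

Lemma mulDl m n k : (m + n) * k = m * k + n * k.
Proof.
  induct k; [rewrite !mul0, !add0; auto|].
  intros k IH; rewrite !mulS, IH, !addA. f_equal.
  rewrite <- !addA; f_equal. apply addC.
Qed.

Lemma mul1l n : 1 * n = n.
Proof.
  induct n; [apply mul0|]. intros n IH; rewrite mulS, IH; auto.
Qed.

Lemma mulC m n : m * n = n * m.
Proof.
  induct n; [rewrite mul0, mul0l; auto|].
  intros n IH; rewrite mulS, mulDl, mul1l, IH; auto.
Qed.

Lemma mulA m n k : m * (n * k) = m * n * k.
Proof.
  induct k; [rewrite !mul0; auto|].
  intros k IH; rewrite !mulS, mulDr, IH; auto.
Qed.

Lemma num_semiring : semi_ring_theory (@zero M) one add mul eq.
Proof.
  constructor; intros; auto using add0l, addC, addA, mul1l, mul0l, mulC, mulA, mulDl.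
Qed.
Add Ring num_ring : num_semiring.

(** * Cancellation and the order *)

Lemma addr_inj x y z : x + z = y + z -> x = y.
Proof.
  induct z; [now rewrite !add0|]. intros z IH; rewrite !addS; intros H.
  apply IH, (succ_inj ax H).
Qed.

Lemma ltS m n : m < n + 1 <-> m <= n.
Proof. apply (lt_succ ax). Qed.

Lemma lt_succ_diag n : n < n + 1.
Proof. apply ltS; auto. Qed.

Lemma lt0S n : 0 < n + 1.
Proof.
  induct n; [rewrite ltS; auto|]. intros n IH; rewrite ltS; auto.
Qed.

Lemma ltSS m n : m < n -> m + 1 < n + 1.
Proof.
  induct n; [intros H; destruct (not_lt0 ax H)|]. intros n IH.
  rewrite (ltS m), (ltS (m + 1)); intros [H| ->]; auto.
Qed.

Lemma lt_add x z : x < x + (z + 1).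
Proof.
  induct z; [rewrite add0l, ltS; auto|]. intros z IH.
  rewrite addS, ltS; auto.
Qed.

Lemma lt_ex x y : x < y <-> exists z, y = x + (z + 1).
Proof.
  split; [|intros [z ->]; apply lt_add].
  (* The bound on [z] makes the statement a bounded formula, as induction requires. *)
  assert (H : x < y -> exists z, z < y /\ y = x + (z + 1)).
  { induct y; [intros H; destruct (not_lt0 ax H)|]. intros y IH.
    rewrite ltS; intros [H| ->].
    - destruct (IH H) as (z & L & E); exists (z + 1); split; [apply ltSS; auto|].
      rewrite E at 1; ring.
    - exists 0; split; [apply lt0S|ring]. }
  intros L; destruct (H L) as (z & _ & E); eauto.
Qed.

Lemma le_ex x y : x <= y <-> exists z, y = x + z.
Proof.
  rewrite <- ltS, lt_ex; split; intros [z E]; exists z.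
  - apply addr_inj with 1; rewrite E; ring.
  - rewrite E; ring.
Qed.

Lemma neq_addS x z : x <> x + (z + 1).
Proof.
  intros H; apply (@succ_neq0 M ax z), addr_inj with x.
  rewrite add0l, addC; auto.
Qed.

Lemma lt_irrefl x : ~ x < x.
Proof. rewrite lt_ex; intros [z H]; exact (neq_addS H). Qed.

Lemma lt_trans x y z : x < y -> y < z -> x < z.
Proof.
  rewrite !lt_ex; intros [a ->] [b ->]; exists (a + b + 1); ring.
Qed.

Lemma le_lt_trans x y z : x <= y -> y < z -> x < z.
Proof. intros [H| ->]; eauto using lt_trans. Qed.

Lemma lt_le_trans x y z : x < y -> y <= z -> x < z.
Proof. intros H [H'| <-]; eauto using lt_trans. Qed.

Lemma le_trans x y z : x <= y -> y <= z -> x <= z.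
Proof. intros [H| ->] [H'| <-]; eauto using lt_trans. Qed.

Lemma zero_or_succ z : z = 0 \/ exists w, z = w + 1.
Proof.
  assert (H : z = 0 \/ exists w, w < z /\ z = w + 1).
  { induct z; [auto|]. intros z _; right; exists z; rewrite ltS; auto. }
  destruct H as [H|(w & _ & H)]; eauto.
Qed.

Lemma lt_or_le x y : x < y \/ y <= x.
Proof.
  induct x.
  - destruct (zero_or_succ y) as [->|[w ->]]; auto using lt0S.
  - intros x [H|H].
    + apply lt_ex in H; destruct H as [z ->].
      destruct (zero_or_succ z) as [->|[w ->]].
      * right; right; ring.
      * left; apply lt_ex; exists w; ring.
    + right; left; rewrite ltS; auto.
Qed.

Lemma le_lt_absurd x y : x <= y -> y < x -> False.
Proof. intros H H'; exact (lt_irrefl (le_lt_trans H H')). Qed.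

Lemma le0 x : 0 <= x.
Proof. apply ltS, lt0S. Qed.

Lemma le_addr x y : x <= x + y.
Proof. apply le_ex; eauto. Qed.

Lemma le_addl x y : x <= y + x.
Proof. apply le_ex; exists y; ring. Qed.

Lemma le_add x y z w : x <= y -> z <= w -> x + z <= y + w.
Proof.
  rewrite !le_ex; intros [a ->] [b ->]; exists (a + b); ring.
Qed.

Lemma le_mul x y z w : x <= y -> z <= w -> x * z <= y * w.
Proof.
  rewrite !le_ex; intros [a ->] [b ->]; exists (x * b + a * z + a * b); ring.
Qed.

Lemma lt_add2r x y z : x < y -> x + z < y + z.
Proof. rewrite !lt_ex; intros [a ->]; exists a; ring. Qed.

Lemma lt_le_succ x y : x < y <-> x + 1 <= y.
Proof.
  rewrite lt_ex, le_ex; split; intros [z ->]; exists z; ring.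
Qed.

Lemma bound2 x y : exists z, x <= z /\ y <= z.
Proof. exists (x + y); auto using le_addr, le_addl. Qed.

Lemma mul_le x z : z <> 0 -> x <= x * z.
Proof.
  intros H; destruct (zero_or_succ z) as [->|[w ->]]; [easy|].
  apply le_ex; exists (x * w); ring.
Qed.

Lemma mul_neq0 x y : x <> 0 -> y <> 0 -> x * y <> 0.
Proof.
  intros Hx Hy.
  destruct (zero_or_succ x) as [->|[a ->]]; [easy|].
  destruct (zero_or_succ y) as [->|[b ->]]; [easy|].
  replace ((a + 1) * (b + 1)) with ((a * b + a + b) + 1) by ring.
  apply (succ_neq0 ax).
Qed.

(** * The pairing function *)

Lemma square_lt x y : x < y -> x * x + x < y * y.
Proof.
  rewrite !lt_ex; intros [z ->]; exists ((z + 1) * z + x * (z + z + 1) + z); ring.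
Qed.

(** Pairs with sum [s] have codes between [s * s] and [s * s + s]. By [square_lt] these ranges are
    disjoint, so the code determines the sum, and then the first component. *)
Lemma pair_inj i x j y : pair i x = pair j y -> i = j /\ x = y.
Proof.
  unfold pair; intros H.
  assert (L : forall i x j y, i + x < j + y ->
    (i + x) * (i + x) + i < (j + y) * (j + y) + j).
  { clear i x j y H; intros i x j y L.
    apply le_lt_trans with ((i + x) * (i + x) + (i + x)).
    { apply le_add; auto; apply le_addr. }
    eapply lt_le_trans; [exact (square_lt L)|apply le_addr]. }
  assert (E : i + x = j + y).
  { destruct (lt_or_le (i + x) (j + y)) as [G|[G|G]]; auto;
      apply L in G; rewrite H in G; destruct (lt_irrefl G). }
  rewrite E in H. rewrite (addC _ i), (addC _ j) in H. apply addr_inj in H.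
  subst j; split; auto. rewrite (addC i), (addC i) in E; apply addr_inj in E; auto.
Qed.

Lemma pair_gel i x : i <= pair i x.
Proof. apply le_addl. Qed.

Lemma pair_ger i x : x <= pair i x.
Proof.
  unfold pair; destruct (zero_or_succ x) as [->|[w ->]]; [apply le0|].
  apply le_ex; exists ((i + w) * (i + w) + i + i + i + w); ring.
Qed.

(** * Derived induction and collection principles *)

Lemma order_induction (P : num M -> Prop) : Delta0 1 (fun e => P (e O)) ->
  (forall n, (forall m, m < n -> P m) -> P n) -> forall n, P n.
Proof.
  intros HP H n.
  assert (G : forall k, forall m, m < k -> P m).
  { intros k; induct k.
    - intros m L; destruct (not_lt0 ax L).
    - intros k IH m; rewrite ltS; intros [L| ->]; auto. }
  apply (G (n + 1)), ltS; auto.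
Qed.

(** A common bound [s] of both witnesses leaves one unbounded quantifier. *)
Lemma sigma_induction2 (Q : num M -> num M -> num M -> Prop) :
  Delta0 3 (fun e => Q (e O) (e 1%nat) (e 2%nat)) -> (exists y z, Q y z 0) ->
  (forall n y z, Q y z n -> exists y z, Q y z (n + 1)) ->
  forall n, exists y z, Q y z n.
Proof.
  intros HQ (y0 & z0 & H0) H1 n.
  destruct (@sigma_induction
    (fun s n => exists y, y <= s /\ exists z, z <= s /\ Q y z n)) with (n := n)
    as (s & y & _ & z & _ & H); [| | |eauto].
  - definable.
  - destruct (bound2 y0 z0) as (s & Ly & Lz); exists s, y0; split; auto; exists z0; auto.
  - intros m s (y & _ & z & _ & H); destruct (H1 _ _ _ H) as (y' & z' & H').
    destruct (bound2 y' z') as (s' & Ly & Lz); exists s', y'; split; auto; exists z'; auto.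
Qed.

(** Induction on [n] enlarges a bound [w] that works for all [i] below both [n] and [t]. *)
Lemma collection t (Q : num M -> num M -> Prop) : Delta0 2 (fun e => Q (e O) (e 1%nat)) ->
  (forall i, i < t -> exists y, Q y i) ->
  exists w, forall i, i < t -> exists y, y <= w /\ Q y i.
Proof.
  intros HQ H.
  destruct (@sigma_induction (fun w n => forall i, i < n -> i < t ->
    exists y, y <= w /\ Q y i)) with (n := t) as (w & Hw); [| | |eauto].
  - definable.
  - exists 0; intros i L; destruct (not_lt0 ax L).
  - intros n w IH. destruct (lt_or_le n t) as [L|L].
    + destruct (H n L) as [y Hy]; destruct (bound2 w y) as (s & L1 & L2); exists s.
      intros i; rewrite ltS; intros [Li| ->] Lt.
      * destruct (IH i Li Lt) as (z & Lz & Hz); exists z; split; eauto using le_trans.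
      * exists y; auto.
    + exists w; intros i; rewrite ltS; intros [Li| ->] Lt; auto.
      destruct (le_lt_absurd L Lt).
Qed.
(** * Codes of finite sets *)

Definition modulus b x : num M := 1 + (x + 1) * b.

(** The bound on the quotient keeps divisibility a bounded formula; for nonzero [d] it costs
    nothing, by [dividesI]. *)
Definition divides d a : Prop := exists q, q <= a /\ a = q * d.

(* As for Goedel's beta function, [c] codes numbers [a], [b] and a bound [l]; the
   members are the [x < l] such that [1 + (x + 1) * b] divides [a]. *)
Definition coded (c x : num M) : Prop :=
  exists a, a <= c /\ exists d, d <= c /\ c = pair a d /\
  exists b, b <= d /\ exists l, l <= d /\ d = pair b l /\
  x < l /\ divides (modulus b x) a.

Lemma dividesI q d a : d <> 0 -> a = q * d -> divides d a.
Proof. intros Hd ->; exists q; split; auto; apply mul_le; auto. Qed.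

Lemma modulus_neq0 b x : modulus b x <> 0.
Proof. unfold modulus; rewrite add1l; apply (succ_neq0 ax). Qed.

Lemma codedE a b l x : coded (pair a (pair b l)) x <-> x < l /\ divides (modulus b x) a.
Proof.
  unfold coded; split.
  - intros (a' & _ & d & _ & E & b' & _ & l' & _ & E' & H).
    apply pair_inj in E; destruct E; subst a' d.
    apply pair_inj in E'; destruct E'; subst b' l'; auto.
  - intros H; exists a; split; [apply pair_gel|].
    exists (pair b l); split; [apply pair_ger|]; split; auto.
    exists b; split; [apply pair_gel|]; exists l; split; [apply pair_ger|]; auto.
Qed.

Lemma coded_lt (c : num M) x : coded c x -> x < c.
Proof.
  intros (a & _ & d & Ld & E & b & _ & l & Ll & E' & L & _).
  eapply lt_le_trans; [exact L|]; eauto using le_trans.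
Qed.

Lemma Delta0_coded : Delta0 2 (fun e => coded (e O) (e 1%nat)).
Proof. unfold coded, divides, modulus. definable. Qed.

(** The induction builds the factorial of [n], for which the language has no term. *)
Lemma common_multiple n :
  exists b, b <> 0 /\ forall i, i < n -> exists q, q <= b /\ b = (i + 1) * q.
Proof.
  revert n; apply sigma_induction with
   (Q := fun b n => b <> 0 /\ forall i, i < n -> exists q, q <= b /\ b = (i + 1) * q).
  - definable.
  - exists 1; split; [rewrite <- (add0l 1); apply (succ_neq0 ax)|].
    intros i L; destruct (not_lt0 ax L).
  - intros n b [Hb H]; exists (b * (n + 1)); split.
    { apply mul_neq0; auto; apply (succ_neq0 ax). }
    intros i; rewrite ltS; intros [L| ->].
    + destruct (H i L) as (q & Lq & E); exists (q * (n + 1)); split.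
      * apply le_mul; auto.
      * rewrite E at 1; ring.
    + exists b; split; [apply mul_le, (succ_neq0 ax)|ring].
Qed.

(** This is [u * a = 1] modulo [d], stated without subtraction. It replaces coprimality, since it
    passes to products without any theory of primes. *)
Definition inverse u a d : Prop := exists v, v <= u * a /\ u * a = v * d + 1.

Lemma inverseI u v a d : u * a = v * d + 1 -> d <> 0 -> inverse u a d.
Proof.
  intros H Hd; exists v; split; auto; rewrite H.
  apply le_trans with (v * d); [apply mul_le; auto|apply le_addr].
Qed.

Lemma inverse_mul u a u' a' d :
  d <> 0 -> inverse u a d -> inverse u' a' d -> inverse (u * u') (a * a') d.
Proof.
  intros Hd (v & _ & H) (v' & _ & H'); apply inverseI with (v * v' * d + v + v'); auto.
  transitivity ((u * a) * (u' * a')); [ring|]. rewrite H, H'; ring.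
Qed.

(** Modulo [1 + P] both [u * a] and [P] are -1, so their product is 1. *)
Lemma inverse_of_opp u v a P :
  P <> 0 -> u * a + 1 = v * (1 + P) -> inverse (P * u) a (1 + P).
Proof.
  intros HP H.
  destruct (zero_or_succ v) as [->|[w ->]].
  { rewrite mul0l in H; destruct (succ_neq0 ax H). }
  destruct (zero_or_succ P) as [->|[Q ->]]; [easy|].
  apply inverseI with (w * Q + w + Q); [|rewrite add1l; apply (succ_neq0 ax)].
  apply addr_inj with (Q + 1).
  transitivity ((Q + 1) * (u * a + 1)); [ring|]. rewrite H; ring.
Qed.

(* Modulo [modulus b y] one has [(y + 1) * modulus b x = y - x] and
   [(y + 1) * b = - 1], so [y - x] dividing [b] makes [modulus b x] a unit. *)
Lemma modulus_coprime b n x y : b <> 0 ->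
  (forall i, i < n -> exists q, q <= b /\ b = (i + 1) * q) ->
  x < n -> y < n -> y <> x -> exists u, inverse u (modulus b x) (modulus b y).
Proof.
  intros Hb H Lx Ly N.
  assert (Y : (y + 1) * b <> 0) by (apply mul_neq0; auto; apply (succ_neq0 ax)).
  destruct (lt_or_le x y) as [L|[L|E]]; [| |easy].
  - destruct (proj1 (lt_ex x y) L) as [z E].
    destruct (H z) as (q & _ & Eq).
    { apply le_lt_trans with y; auto; rewrite E, addA; left; apply lt_le_trans with (z + 1).
      - apply ltS; auto.
      - rewrite <- addA; apply le_addl. }
    (* Multiplying [y - x] by [q * (y + 1)] gives [b * (y + 1)], which is -1; the factor
       [(y + 1) * b] corrects the sign. *)
    exists ((y + 1) * b * (q * (y + 1) * (y + 1))).
    apply inverse_of_opp with (1 + q * (x + 1) * (y + 1)); auto.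
    unfold modulus.
    transitivity (1 + (y + 1) * (q * ((y + 1) * (1 + (x + 1) * b)))); [ring|].
    transitivity (1 + (y + 1) * ((z + 1) * q) + q * (x + 1) * (y + 1) * (1 + (y + 1) * b)).
    + rewrite E; ring.
    + rewrite <- Eq; ring.
  - destruct (proj1 (lt_ex y x) L) as [z E].
    destruct (H z) as (q & _ & Eq).
    { apply le_lt_trans with x; auto; rewrite E, addA; left; apply lt_le_trans with (z + 1).
      - apply ltS; auto.
      - rewrite <- addA; apply le_addl. }
    destruct (zero_or_succ q) as [->|[r ->]]; [rewrite mul0 in Eq; easy|].
    (* Here [y - x] is negative, so the same multiplication gives 1 directly. Writing [q] as [r + 1]
       avoids subtraction in the cofactor. *)
    exists ((r + 1) * (y + 1) * (y + 1)).
    apply inverseI with (r * (x + 1) * (y + 1) + x * y + x + y); [|apply modulus_neq0].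
    apply addr_inj with ((y + 1) * b).
    transitivity ((r + 1) * (y + 1) * (y + 1) * modulus b x +
      (y + 1) * ((z + 1) * (r + 1))).
    + rewrite <- Eq; auto.
    + unfold modulus; rewrite E; ring.
Qed.

(** Otherwise [1 + P], which exceeds 1, would divide 1. *)
Lemma inverse_not_divides u a P : P <> 0 -> inverse u a (1 + P) -> ~ divides (1 + P) a.
Proof.
  intros HP (v & _ & E) (q & _ & ->).
  destruct (lt_or_le v (u * q)) as [L|L].
  - apply lt_ex in L; destruct L as [z L].
    assert (H : (1 + P) * (z + 1) = 1).
    { apply addr_inj with (v * (1 + P)). rewrite (addC 1 (v * _)), <- E, mulA, L; ring. }
    apply (@le_lt_absurd (1 + P) 1).
    + apply le_trans with ((1 + P) * (z + 1)); [apply mul_le, (succ_neq0 ax)|auto].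
    + destruct (zero_or_succ P) as [->|[w ->]]; [easy|apply lt_add].
  - apply (@le_lt_absurd (u * (q * (1 + P))) (v * (1 + P))).
    + rewrite mulA; apply le_mul; auto.
    + rewrite E; apply ltS; auto.
Qed.

(** The coding number is the product of the moduli of the members. The induction also carries, for
    each nonmember, an inverse witnessing that its modulus does not divide the product. *)
Lemma code_initial X n : exists c : num M, forall x, coded c x <-> x < n /\ x ∈ X.
Proof.
  destruct (common_multiple n) as (b & Hb & H).
  assert (G : forall m, exists a w, m <= n -> forall y, y < n ->
    ((y < m /\ y ∈ X) /\ divides (modulus b y) a) \/
    ~ (y < m /\ y ∈ X) /\ exists u, u <= w /\ inverse u a (modulus b y)).
  { apply sigma_induction2 with (Q := fun a w m => m <= n -> forall y, y < n ->
    ((y < m /\ y ∈ X) /\ divides (modulus b y) a) \/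
    ~ (y < m /\ y ∈ X) /\ exists u, u <= w /\ inverse u a (modulus b y)).
    - unfold divides, inverse, modulus; definable.
    - exists 1, 1; intros _ y Ly; right; split.
      { intros [L _]; destruct (not_lt0 ax L). }
      exists 1; split; auto; apply inverseI with 0; [ring|apply modulus_neq0].
    - intros m a w IH.
      destruct (classic (m + 1 <= n /\ m ∈ X)) as [[Lm Hm]|N].
      + specialize (IH (le_trans (or_introl (lt_succ_diag m)) Lm)).
        (* Each step changes all the inverses; a common bound for the new ones keeps the induction
           predicate in Sigma01 form. *)
        destruct (@collection n (fun u y => (y < m + 1 /\ y ∈ X) \/
          inverse u (a * modulus b m) (modulus b y))) as [w' Hw].
        { unfold inverse, modulus; definable. }
        { intros y Ly. destruct (IH y Ly) as [[[L1 L2] _]|[N (u & _ & Hu)]].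
          - exists 0; left; split; auto; apply ltS; auto.
          - destruct (classic (y = m)) as [->|Nm].
            + exists 0; left; split; auto; apply ltS; auto.
            + destruct (@modulus_coprime b n m y) as [u' Hu']; auto.
              { apply lt_le_succ; auto. }
              exists (u * u'); right; apply inverse_mul; auto using modulus_neq0. }
        exists (a * modulus b m), w'; intros _ y Ly.
        destruct (classic (y < m + 1 /\ y ∈ X)) as [L|N]; [left|right]; split; auto.
        * destruct (IH y Ly) as [[_ (q & _ & E)]|[N _]].
          -- apply dividesI with (q * modulus b m); [apply modulus_neq0|].
             rewrite E at 1; ring.
          -- destruct L as [L HX]; apply ltS in L; destruct L as [L| ->]; [tauto|].
             apply dividesI with a; [apply modulus_neq0|auto].
        * destruct (Hw y Ly) as (u & Lu & [L|Hu]); [tauto|eauto].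
      + exists a, w; intros L y Ly.
        specialize (IH (le_trans (or_introl (lt_succ_diag m)) L) y Ly).
        assert (E : y < m + 1 /\ y ∈ X <-> y < m /\ y ∈ X).
        { rewrite ltS; split; intros [L1 L2]; split; auto.
          destruct L1 as [L1| ->]; auto; tauto. }
        tauto. }
  destruct (G n) as (a & w & Ha); specialize (Ha (or_intror eq_refl)).
  exists (pair a (pair b n)); intros x; rewrite codedE; split; intros [L Hx]; split; auto.
  - destruct (Ha x L) as [[[_ HX] _]|[_ (u & _ & v & Lv & E)]]; auto.
    destruct (@inverse_not_divides u a ((x + 1) * b)); auto.
    + apply mul_neq0; auto; apply (succ_neq0 ax).
    + exists v; auto.
  - destruct (Ha x L) as [[_ Hd]|[N _]]; auto; tauto.
Qed.

(** * Elimination of unbounded quantifiers *)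

(** The accumulator [a] is the first variable. Pairing it with the next one lets an induction absorb
    the variables one by one. *)
Fixpoint code (k : nat) a e : num M :=
  match k with
  | O => a
  | S k => code k (pair a (e O)) (fun i => e (S i))
  end.

Lemma Poly_code l k : forall f (g : nat -> (nat -> num M) -> num M), Poly l f ->
  (forall i, (i < k)%nat -> Poly l (g i)) ->
  Poly l (fun e => code k (f e) (fun i => g i e)).
Proof.
  induction k as [|k IH]; intros f g Hf Hg; simpl; auto.
  apply (IH (fun e => pair (f e) (g O e)) (fun i => g (S i))).
  - pose proof (Hg O (Nat.lt_0_succ k)); unfold pair.
    apply Poly_add; auto. apply Poly_mul; apply Poly_add; auto.
  - intros i Hi; apply Hg; lia.
Qed.

(** Induction on [k]: the first two parameters are replaced by their pair and recovered by bounded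
    quantifiers. The variable [y] stays outside the code, ready to be projected away. *)
Lemma code_set k : forall P, Delta0 (S (S k)) P ->
  exists X, forall y a e, pair y (code k a e) ∈ X <-> P (push y (push a e)).
Proof.
  induction k as [|k IH]; intros P HP.
  - destruct (@comprehension (fun n => exists y, y <= n /\ exists a, a <= n /\
      n = pair y a /\ P (push y (fun _ => a)))) as [X HX].
    (* Under the two quantifiers the variables are [a], [y], [n] in this order, hence the swap. *)
    { definable. apply (@Delta0_sub 2 3 P (fun i => match i with O => 1 | _ => O end)%nat
        (fun e => push (e 1%nat) (fun _ => e O))); auto.
      - intros [|i]; lia.
      - intros ? [|i]; auto. }
    assert (E : forall y a e, P (push y (fun _ => a)) <-> P (push y (push a e))).
    { intros y a e; apply (Delta0_env HP); intros [|[|i]]; simpl; auto; lia. }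
    exists X; intros y a e; simpl; rewrite HX, <- E; split.
    + intros (y' & _ & a' & _ & Ep & H); apply pair_inj in Ep; destruct Ep; subst; auto.
    + intros H; exists y; split; [apply pair_gel|].
      exists a; split; [apply pair_ger|auto].
  - destruct (IH (fun e => exists a, a <= e 1%nat /\ exists b, b <= e 1%nat /\
      e 1%nat = pair a b /\ P (push (e O) (push a (push b (fun i => e (S (S i))))))))
      as [X HX].
    { definable. apply (@Delta0_sub (S (S (S k))) _ P
        (fun i => match i with O => 2 | 1 => 1 | 2 => 0 | S (S (S i)) => 4 + i end)%nat
        (fun e => push (e 2%nat) (push (e 1%nat) (push (e O) (fun i => e (4 + i)%nat)))));
        auto.
      - intros [|[|[|i]]]; lia.
      - intros ? [|[|[|i]]]; simpl; auto. }
    assert (E : forall y a e, P (push y (push a (push (e O) (fun i => e (S i))))) <->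
      P (push y (push a e))).
    { intros y a e; apply (Delta0_env HP); intros [|[|[|i]]]; simpl; auto. }
    exists X; intros y a e; simpl; rewrite HX, <- E; simpl; split.
    + intros (y' & _ & a' & _ & Ep & H); apply pair_inj in Ep; destruct Ep; subst; auto.
    + intros H; exists a; split; [apply pair_gel|].
      exists (e O); split; [apply pair_ger|auto].
Qed.

(* Over RCA0 this single instance of Sigma^0_1 comprehension gives all of ACA0:
   coding the free variables of a bounded formula by one number turns an
   unbounded quantifier into a projection, hence into an atomic formula. *)
Definition projections_exist : Prop :=
  forall Y, exists X, forall n, n ∈ X <-> exists m, pair m n ∈ Y.

Lemma Delta0_exists (HM : projections_exist) k (Q : num M -> (nat -> num M) -> Prop) :
  Delta0 (S k) (fun e => Q (e O) (fun i => e (S i))) -> Delta0 k (fun e => exists y, Q y e).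
Proof.
  destruct k as [|k]; intros HQ.
  (* Without free variables the statement has a fixed truth value, and a trivial formula expresses
     it. *)
  - set (e0 := fun _ : nat => @zero M).
    assert (E : forall e, (exists y, Q y e) <-> exists y, Q y e0).
    { intros e; split; intros [y Hy]; exists y; revert Hy.
      - apply (Delta0_env (e := push y e) (e' := push y e0) HQ);
          intros [|i]; simpl; auto; lia.
      - apply (Delta0_env (e := push y e0) (e' := push y e) HQ);
          intros [|i]; simpl; auto; lia. }
    destruct (classic (exists y, Q y e0)) as [H|H].
    + apply Delta0_iff with (fun _ => @zero M = 0); [definable|].
      intros e; rewrite E; tauto.
    + apply Delta0_iff with (fun _ => ~ @zero M = 0); [definable|].
      intros e; rewrite E; tauto.
  - destruct (code_set HQ) as [Y HY]. destruct (HM Y) as [X HX].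
    apply Delta0_iff with (fun e => code k (e O) (fun i => e (S i)) ∈ X).
    + apply Delta0_mem.
      apply (@Poly_code (S k) k (fun e => e O) (fun i e => e (S i))).
      * apply Poly_var; lia.
      * intros i Hi; apply Poly_var; lia.
    + assert (E : forall y e, Q y e <-> Q y (push (e O) (fun i => e (S i)))).
      { intros y e. apply (Delta0_env (e := push y e)
          (e' := push y (push (e O) (fun i => e (S i)))) HQ).
        intros [|[|i]]; simpl; auto. }
      intros e; rewrite HX; split; intros [y Hy]; exists y.
      * apply HY. exact (proj1 (E y e) Hy).
      * apply HY in Hy. exact (proj2 (E y e) Hy).
Qed.

Lemma Delta0_forall (HM : projections_exist) k (Q : num M -> (nat -> num M) -> Prop) :
  Delta0 (S k) (fun e => Q (e O) (fun i => e (S i))) -> Delta0 k (fun e => forall y, Q y e).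
Proof.
  intros HQ; apply Delta0_iff with (fun e => ~ exists y, ~ Q y e).
  - apply Delta0_not, (Delta0_exists HM), Delta0_not; auto.
  - intros e; split; [intros H [y Hy]; auto|].
    intros H y; apply NNPP; eauto.
Qed.

Lemma Poly_eval t k (c : nat -> num M) : Poly k (fun e => eval (cat k e c) t).
Proof. exists t, c; auto. Qed.

Lemma Delta0_sat (HM : projections_exist) p :
  forall (v : nat -> set M) k (c : nat -> num M),
  Delta0 k (fun e => sat (cat k e c) v p).
Proof.
  induction p; intros v k c; simpl.
  - apply Delta0_eq; apply Poly_eval.
  - apply Delta0_lt; apply Poly_eval.
  - apply Delta0_mem, Poly_eval.
  - apply Delta0_not; auto.
  - apply Delta0_and; auto.
  - apply Delta0_or; auto.
  - apply Delta0_imp; auto.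
  - apply (Delta0_forall HM), (IHp v (S k) c).
  - apply (Delta0_exists HM), (IHp v (S k) c).
Qed.

Lemma arithmetical_comprehensionP : arithmetical_comprehension M <-> projections_exist.
Proof.
  split.
  - intros H Y.
    (* The formula spells out [pair m n ∈ Y], with [m] as variable 0 and [n] as variable 1. *)
    destruct (H (Ex (Mem (Add (Mul (Add (Var 0) (Var 1)) (Add (Var 0) (Var 1))) (Var 0)) 0))
      (fun _ => 0) (fun _ => Y)) as [X HX].
    exists X; auto.
  - intros HM p c v; apply comprehension with (P := fun n => sat (push n c) v p).
    apply (Delta0_sat HM p v 1 c).
Qed.

(** * The reversal *)

Lemma sequence (R : num M -> num M -> Prop) :
  Delta0 2 (fun e => R (e O) (e 1%nat)) -> exists Z, forall i x, at_index Z i x <-> R i x.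
Proof.
  intros HR; destruct (@comprehension (fun z => exists i, i <= z /\ exists x, x <= z /\
    z = pair i x /\ R i x)) as [Z HZ]; [definable|].
  exists Z; intros i x; unfold at_index; rewrite HZ; split.
  - intros (i' & _ & x' & _ & E & H); apply pair_inj in E; destruct E; subst; auto.
  - intros H; exists i; split; [apply pair_gel|].
    exists x; split; [apply pair_ger|auto].
Qed.

Lemma in_seq_iff Z (P Q : num M -> Prop) :
  (forall x, P x <-> Q x) -> in_seq Z P -> in_seq Z Q.
Proof. intros E [k H]; exists k; intros x; rewrite H; auto. Qed.

Definition cofinite (P : num M -> Prop) : Prop := finite (fun x => ~ P x).

(** * The algebra of finite sets, cofinite sets and initial segments *)

Section Algebra.
Context (Y : set M).

Definition avoids n x : Prop := forall m, m < x -> ~ pair m n ∈ Y.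

(* Every [avoids n] is an initial segment, so a member of this algebra is finite
   or cofinite. The codes of finite sets make the algebra closed under the
   operations; only unions need a uniform bound, obtained by collection. *)
Definition algebra_member i x : Prop :=
  exists c, c <= i /\ exists t, t <= i /\ i = pair c t /\
  (t = 0 /\ coded c x \/ t = 1 /\ ~ coded c x \/
   exists n, n < t /\ t = n + 1 + 1 /\ avoids n x).

Context (Z : set M) (HZ : forall i x, at_index Z i x <-> algebra_member i x).

Lemma member_finite c x : at_index Z (pair c 0) x <-> coded c x.
Proof.
  rewrite HZ; split.
  - intros (c' & _ & t & _ & E & H); apply pair_inj in E; destruct E; subst c' t.
    destruct H as [[_ H]|[[E _]|(n & _ & E & _)]]; auto; exfalso.
    + apply (succ_neq0 ax (n := 0)); rewrite add0l; auto.
    + apply (succ_neq0 ax (n := n + 1)); auto.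
  - intros H; exists c; split; [apply pair_gel|]; exists 0; split; [apply pair_ger|auto].
Qed.

Lemma member_cofinite c x : at_index Z (pair c 1) x <-> ~ coded c x.
Proof.
  rewrite HZ; split.
  - intros (c' & _ & t & _ & E & H); apply pair_inj in E; destruct E; subst c' t.
    destruct H as [[E _]|[[_ H]|(n & _ & E & _)]]; auto; exfalso.
    + apply (succ_neq0 ax (n := 0)); rewrite add0l; auto.
    + apply (succ_neq0 ax (n := n)), (succ_inj ax); rewrite add0l; auto.
  - intros H; exists c; split; [apply pair_gel|]; exists 1; split; [apply pair_ger|auto].
Qed.

Lemma member_avoids c n x : at_index Z (pair c (n + 1 + 1)) x <-> avoids n x.
Proof.
  rewrite HZ; split.
  - intros (c' & _ & t & _ & E & H); apply pair_inj in E; destruct E; subst c' t.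
    destruct H as [[E _]|[[E _]|(m & _ & E & H)]].
    + destruct (succ_neq0 ax E).
    + exfalso. apply (succ_neq0 ax (n := n)), (succ_inj ax); rewrite add0l; auto.
    + apply (succ_inj ax), (succ_inj ax) in E; subst; auto.
  - intros H; exists c; split; [apply pair_gel|].
    exists (n + 1 + 1); split; [apply pair_ger|]; split; auto.
    right; right; exists n; split; auto. apply lt_trans with (n + 1); apply ltS; auto.
Qed.

(** The index itself is the bound in the first two cases, so all such members with index below [d]
    share the bound [d]. Numbers that are not pairs index the empty set. *)
Lemma member_cases i : (forall x, at_index Z i x -> x < i) \/
  (forall x, ~ at_index Z i x -> x < i) \/
  (forall x y, x <= y -> at_index Z i y -> at_index Z i x).
Proof.
  destruct (classic (exists c t, i = pair c t)) as [(c & t & ->)|N].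
  - destruct (zero_or_succ t) as [->|[s ->]].
    { left; intros x; rewrite member_finite; intros H.
      eapply lt_le_trans; [exact (coded_lt H)|apply pair_gel]. }
    destruct (zero_or_succ s) as [->|[n ->]].
    { rewrite add0l; right; left; intros x; rewrite member_cofinite; intros H.
      apply NNPP in H; eapply lt_le_trans; [exact (coded_lt H)|apply pair_gel]. }
    right; right; intros x y L; rewrite !member_avoids; intros H m Lm.
    apply H; eapply lt_le_trans; eauto.
  - left; intros x H; exfalso; apply HZ in H.
    destruct H as (c & _ & t & _ & E & _); eauto.
Qed.

Lemma finite_in_algebra (P : num M -> Prop) :
  Delta0 1 (fun e => P (e O)) -> finite P -> exists c, forall x, coded c x <-> P x.
Proof.
  intros HP [k Hk]; destruct (comprehension HP) as [X HX].
  destruct (code_initial X k) as [c Hc]; exists c; intros x; rewrite Hc, HX.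
  split; [tauto|auto].
Qed.

(** This reduces each closure condition to showing that a definable set is finite or cofinite. *)
Lemma in_algebra (P : num M -> Prop) :
  Delta0 1 (fun e => P (e O)) -> finite P \/ cofinite P -> in_seq Z P.
Proof.
  intros HP [F|F]; apply finite_in_algebra in F; auto; try definable; destruct F as [c Hc].
  - exists (pair c 0); intros x; rewrite member_finite; auto.
  - exists (pair c 1); intros x; rewrite member_cofinite, Hc; split; [apply NNPP|tauto].
Qed.

Lemma member_finite_or_cofinite i : finite (at_index Z i) \/ cofinite (at_index Z i).
Proof.
  destruct (member_cases i) as [H|[H|H]]; [left; exists i; auto|right; exists i; auto|].
  destruct (classic (forall x, at_index Z i x)) as [G|G].
  - right; exists 0; intros x N; destruct N; auto.
  - apply not_all_ex_not in G; destruct G as [x Hx]; left; exists x; intros y Hy.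
    destruct (lt_or_le y x) as [L|L]; auto. destruct Hx; eauto.
Qed.

Lemma algebra_translation : translation_closed Z.
Proof.
  intros i n; apply in_algebra; [definable|].
  destruct (member_finite_or_cofinite i) as [[k H]|[k H]]; [left|right]; exists k;
    intros x Hx; apply le_lt_trans with (x + n); auto using le_addr.
Qed.

Lemma algebra_countable : countable_algebra Z.
Proof.
  constructor.
  - intros X [d Hd].
    apply in_seq_iff with (fun x => forall i, i < d -> i ∈ X -> at_index Z i x).
    { intros x; split; auto. }
    apply in_algebra; [definable|].
    destruct (classic (exists i, i ∈ X /\ finite (at_index Z i)))
      as [(i & Hi & k & Hk)|N].
    { left; exists k; auto. }
    (* A member missing [x] is neither finite nor an initial segment, since the latter would be
       bounded by [x]. So [x] lies below its index, hence below [d]. *)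
    right; exists d; intros x Hx. apply not_all_ex_not in Hx; destruct Hx as [i Hi].
    apply imply_to_and in Hi; destruct Hi as [Ld Hi].
    apply imply_to_and in Hi; destruct Hi as [HX Hx].
    apply lt_trans with i; auto. destruct (member_cases i) as [H|[H|H]]; auto; exfalso.
    + apply N; exists i; split; auto; exists i; auto.
    + apply N; exists i; split; auto; exists x; intros y Hy.
      destruct (lt_or_le y x) as [L|L]; auto. destruct Hx; eauto.
  - intros X [d Hd].
    apply in_seq_iff with (fun x => exists i, i < d /\ i ∈ X /\ at_index Z i x).
    { intros x; split; [intros (i & _ & H)|intros (i & H & G)]; eauto. }
    apply in_algebra; [definable|].
    destruct (classic (exists i, i ∈ X /\ cofinite (at_index Z i)))
      as [(i & Hi & k & Hk)|N].
    { right; exists k; intros x Hx; apply Hk; intros G; apply Hx; eauto. }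
    left.
    (* Every member misses some point [s] between [d] and [w]. It cannot contain an [x] past [s]:
       the first two cases of [member_cases] fail as [d <= s], and an initial segment would contain
       [s]. *)
    destruct (@collection d (fun s i => i ∈ X -> d <= s /\ ~ at_index Z i s)) as [w Hw].
    { definable. }
    { intros i Li. destruct (classic (i ∈ X)) as [Hi|Hi]; [|exists 0; tauto].
      apply NNPP; intros G; apply N; exists i; split; auto; exists d; intros x Hx.
      destruct (lt_or_le x d) as [L|L]; auto. destruct G; exists x; auto. }
    exists (w + 1); intros x (i & Li & Hi & Hx). apply ltS.
    destruct (Hw i Li) as (s & Ls & Hs). destruct (Hs Hi) as [Ld Ns].
    destruct (lt_or_le x s) as [L|L]; [left; eapply lt_le_trans; eauto|].
    exfalso; destruct (member_cases i) as [H|[H|H]].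
    + apply (@le_lt_absurd i x); auto. left; eapply lt_le_trans; [|exact L].
      eapply lt_le_trans; eauto.
    + apply (@le_lt_absurd d s); auto. apply H in Ns. eapply lt_trans; eauto.
    + apply Ns, (H s x); auto.
  - intros i; apply in_algebra; [definable|].
    destruct (member_finite_or_cofinite i) as [[k H]|[k H]]; [right|left]; exists k; auto.
    intros x Hx; apply H, NNPP; auto.
Qed.
End Algebra.

(** Asking for ultrafilters only on translation closed algebras lets both ultrafilter statements
    imply the hypothesis. *)
Lemma projections_of_ultrafilters :
  (forall Z, countable_algebra Z -> translation_closed Z ->
    exists F, partial_nonprincipal_ultrafilter Z F) -> projections_exist.
Proof.
  intros H Y.
  destruct (@sequence (algebra_member Y)) as [Z HZ].
  { pose proof Delta0_coded; unfold algebra_member, avoids; definable. }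
  destruct (H Z (algebra_countable HZ) (algebra_translation HZ)) as [F HF].
  (* Any first component would do: [avoids n] has the index [pair c (n + 1 + 1)] for every [c]. *)
  destruct (@comprehension (fun n => ~ pair 0 (n + 1 + 1) ∈ F)) as [X HX]; [definable|].
  exists X; intros n; rewrite HX; split.
  - intros N; apply NNPP; intros G; apply N.
    destruct (filter_ultra HF (pair 0 (n + 1 + 1))) as [I|(k & I & E)]; auto.
    (* If nothing projects to [n], the complement of [avoids n] is empty and cannot be in [F]. *)
    destruct (filter_infinite HF I); exists 0; intros x Hx. apply E in Hx.
    destruct Hx; apply (member_avoids HZ); intros m _ Hm; eauto.
  - intros [m Hm] I; apply (filter_infinite HF I); exists (m + 1); intros x.
    rewrite (member_avoids HZ), ltS; intros Hx.
    destruct (lt_or_le m x) as [L|L]; auto. destruct (Hx m L Hm).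
Qed.

Ltac definable_unbounded ::=
  match goal with
  | HM : projections_exist |- Delta0 _ (fun e => exists y, _) =>
      apply (Delta0_exists HM); definable
  | HM : projections_exist |- Delta0 _ (fun e => forall y, _) =>
      apply (Delta0_forall HM); definable
  end.

(** * Construction of ultrafilters *)

Section Ultrafilters.
Context (HM : projections_exist).

(* Recursion along the numbers: by [code_initial] the initial segments of [F] have
   codes, so that [F] is arithmetically definable. *)
Lemma greedy (Psi : num M -> (num M -> Prop) -> Prop) :
  Delta0 2 (fun e => Psi (e O) (coded (e 1%nat))) ->
  (forall i (S S' : num M -> Prop), (forall l, l < i -> (S l <-> S' l)) ->
    Psi i S -> Psi i S') ->
  exists F, forall i, i ∈ F <-> Psi i (fun l => l ∈ F).
Proof.
  intros HD Hext.
  pose proof Delta0_coded as HC.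
  set (Phi := fun i c => Psi i (coded c)).
  assert (HP : Delta0 2 (fun e => Phi (e O) (e 1%nat))) by exact HD.
  assert (Pext : forall i c c', (forall l, l < i -> (coded c l <-> coded c' l)) ->
    (Phi i c <-> Phi i c')).
  { intros i c c' E; split; apply Hext; auto. intros l L; rewrite (E l L); tauto. }
  (* Such a [c] codes a correct run of the recursion below [n]. *)
  set (good := fun c n => forall j, j < n -> (coded c j <-> Phi j c)).
  assert (HG : Delta0 2 (fun e => good (e O) (e 1%nat))).
  { unfold good; clearbody Phi; definable. }
  assert (G : forall n, exists c, good c n).
  { apply sigma_induction; auto.
    - exists 0; intros j L; destruct (not_lt0 ax L).
    - intros n c Hc.
      destruct (@comprehension (fun x => x < n /\ coded c x \/ x = n /\ Phi n c)) as [X HX].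
      { clearbody Phi; definable. }
      destruct (code_initial X (n + 1)) as [c' Hc'].
      assert (E : forall l, l < n -> (coded c l <-> coded c' l)).
      { intros l L; rewrite Hc', HX, ltS. split; [tauto|].
        intros [_ [H|[-> _]]]; [tauto|destruct (lt_irrefl L)]. }
      exists c'; intros j; rewrite ltS; intros [L| ->].
      + rewrite <- (E j L), (Hc j L); apply Pext; intros l Ll; apply E.
        eapply lt_trans; eauto.
      + rewrite <- (Pext n c c' E), Hc', HX, ltS; split; [|tauto].
        intros [_ [[L _]|H]]; [destruct (lt_irrefl L)|tauto]. }
  (* Correct runs agree, because [Phi j] depends only on entries below [j]; hence [F] can be read
     off any of them. *)
  assert (U : forall c c' n, good c n -> good c' n ->
    forall j, j < n -> (coded c j <-> coded c' j)).
  { intros c c' n Hc Hc'.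
    apply (@order_induction (fun j => j < n -> (coded c j <-> coded c' j))).
    - definable.
    - intros j IH L; rewrite (Hc j L), (Hc' j L); apply Pext.
      intros l Ll; apply IH; auto. eapply lt_trans; eauto. }
  assert (W : forall c m n, m <= n -> good c n -> good c m).
  { intros c m n L H j Lj; apply H; eapply lt_le_trans; eauto. }
  destruct (@comprehension (fun i => exists c, good c (i + 1) /\ coded c i)) as [F HF].
  { clearbody good; definable. }
  assert (E : forall c n l, good c n -> l < n -> (l ∈ F <-> coded c l)).
  { intros c n l Hc L; rewrite HF.
    apply lt_le_succ in L.
    assert (Ll : l < l + 1) by (apply ltS; auto).
    split.
    - intros (c' & Hc' & H). apply (U c c' (l + 1)); eauto.
    - intros H; exists c; eauto. }
  exists F; intros i. destruct (G (i + 1)) as [c Hc].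
  assert (Li : i < i + 1) by (apply ltS; auto).
  rewrite (E c _ i Hc Li), (Hc i Li).
  assert (E' : forall l, l < i -> (coded c l <-> l ∈ F)).
  { intros l L; rewrite (E c (i + 1)); eauto using lt_trans; tauto. }
  split; apply Hext; auto. intros l L; rewrite (E' l L); tauto.
Qed.

(** An index is accepted if, for every [m], some point past [m] satisfying [E m] lies in its set and
    agrees with the earlier choices. As [E m] strengthens with [m], it can impose infinitely many
    requirements in the limit. *)
Lemma ultrafilter_branch Z (E : num M -> num M -> Prop) :
  Delta0 2 (fun e => E (e O) (e 1%nat)) ->
  (forall m m' x, m <= m' -> E m' x -> E m x) ->
  (forall m, exists x, m <= x /\ E m x) ->
  exists F, forall n m, exists x, m <= x /\ E m x /\
    forall l, l < n -> (l ∈ F <-> at_index Z l x).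
Proof.
  intros HE Hdec Hinf. pose proof Delta0_coded as HC.
  destruct (@greedy (fun i S => forall m, exists x, m <= x /\ E m x /\ at_index Z i x /\
    forall l, l < i -> (S l <-> at_index Z l x))) as [F HF].
  { definable. }
  { intros i S S' HS H m; destruct (H m) as (x & L & Ex & Hx & G); exists x.
    repeat split; auto; intros Hl.
    - apply G, HS; auto.
    - apply HS, G; auto. }
  exists F; intros n; induct n.
  - intros m; destruct (Hinf m) as (x & L & Ex); exists x; repeat split; auto;
      destruct (not_lt0 ax H).
  - intros n IH. destruct (classic (n ∈ F)) as [Hn|Hn].
    + intros m. destruct (proj1 (HF n) Hn m) as (x & L & Ex & Hx & G).
      exists x; split; auto; split; auto.
      intros l; rewrite ltS; intros [Ll| ->]; auto; tauto.
    (* Rejection of [n] fails at some [m0], so the realizing points beyond both [m] and [m0] lie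
       outside the set with index [n]. *)
    + pose proof Hn as N. rewrite HF in N. apply not_all_ex_not in N. destruct N as [m0 N].
      intros m. destruct (bound2 m m0) as (m1 & L & L0).
      destruct (IH m1) as (x & Lx & Ex & G).
      exists x; split; [eapply le_trans; eauto|]. split; [eauto|].
      intros l; rewrite ltS; intros [Ll| ->]; auto. split; intros H; exfalso.
      * auto.
      * apply N; exists x; split; [eapply le_trans; eauto|]; split; eauto.
Qed.

Definition branch Z F : Prop := forall n, exists x, n <= x /\
  forall l, l < n -> (l ∈ F <-> at_index Z l x).

Lemma bound3 x y z : exists w, x < w /\ y < w /\ z < w.
Proof.
  exists (x + y + z + 1); rewrite !ltS; split; [|split].
  - rewrite <- addA; apply le_addr.
  - rewrite <- addA; apply le_trans with (y + z); [apply le_addr|apply le_addl].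
  - apply le_addl.
Qed.

(** Below any bound [F] agrees with the principal ultrafilter of a large point. Each axiom concerns
    few indices and can be checked at such a point. *)
Lemma branch_ultrafilter Z F :
  countable_algebra Z -> branch Z F -> partial_nonprincipal_ultrafilter Z F.
Proof.
  intros HZ HF; constructor.
  - intros i j Hi H. destruct (bound3 i j 0) as (n & Li & Lj & _).
    destruct (HF n) as (x & _ & G). apply G; auto. apply H, G; auto.
  - intros i j Hi Hj.
    destruct (@comprehension (fun l => l = i \/ l = j)) as [X HX]; [definable|].
    destruct (@algebra_inter _ _ HZ X) as [k Hk].
    { destruct (bound3 i j 0) as (n & Li & Lj & _); exists n.
      intros l; rewrite HX; intros [->| ->]; auto. }
    assert (E : forall x, at_index Z k x <-> at_index Z i x /\ at_index Z j x).
    { intros x; rewrite Hk; split.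
      - intros H; split; apply H, HX; auto.
      - intros [H1 H2] l; rewrite HX; intros [->| ->]; auto. }
    exists k; split; auto. destruct (bound3 i j k) as (n & Li & Lj & Lk).
    destruct (HF n) as (x & _ & G). apply G; auto. apply E; split; apply G; auto.
  - intros i Hi [k Hk]. destruct (bound3 i k 0) as (n & Li & Lk & _).
    destruct (HF n) as (x & L & G). apply (@le_lt_absurd k x).
    + left; eapply lt_le_trans; eauto.
    + apply Hk, G; auto.
  - intros i. destruct (algebra_compl HZ i) as [k Hk].
    destruct (classic (i ∈ F)) as [Hi|Hi]; [auto|right]. exists k; split; auto.
    destruct (bound3 i k 0) as (n & Li & Lk & _). destruct (HF n) as (x & _ & G).
    apply G; auto. apply Hk. rewrite <- G; auto.
Qed.

Lemma nonprincipal_ultrafilters : partial_nonprincipal_ultrafilters_exist M.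
Proof.
  intros Z HZ.
  (* No requirement is imposed here, so [E] is trivially true. *)
  destruct (@ultrafilter_branch Z (fun _ x => x = x)) as [F HF]; auto.
  - definable.
  - intros m; exists m; auto.
  - exists F; apply branch_ultrafilter; auto.
    intros n; destruct (HF n n) as (x & L & _ & G); eauto.
Qed.

(** * Thick sets and minimal ultrafilters *)

Definition thick (P : num M -> Prop) : Prop :=
  forall m, exists x, forall y, x <= y -> y <= x + m -> P y.

(* [J] collects greedily the indices whose complements still have a thick
   intersection. An ultrafilter containing all translates of these complements
   only has members outside [J], and maximality makes their return times
   syndetic. *)
Lemma maximal_thick Z : exists J,
  (forall i, thick (fun y => forall l, l < i -> l ∈ J -> ~ at_index Z l y)) /\
  (forall i, thick (fun y => ~ at_index Z i y /\
    forall l, l < i -> l ∈ J -> ~ at_index Z l y) -> i ∈ J).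
Proof.
  pose proof Delta0_coded as HC.
  destruct (@greedy (fun i S => thick (fun y => ~ at_index Z i y /\
    forall l, l < i -> S l -> ~ at_index Z l y))) as [J HJ].
  { unfold thick; definable. }
  { intros i S S' HS H m; destruct (H m) as [x Hx]; exists x; intros y L1 L2.
    destruct (Hx y L1 L2) as [N G]; split; auto.
    intros l L Hl; apply G; auto; apply HS; auto. }
  exists J; split; [|intros i; apply HJ].
  intros i; induct i.
  - unfold thick; definable.
  - intros m; exists 0; intros y _ _ l L; destruct (not_lt0 ax L).
  - intros i IH. destruct (classic (i ∈ J)) as [Hi|Hi].
    + intros m. destruct (proj1 (HJ i) Hi m) as [x Hx]; exists x; intros y L1 L2 l.
      destruct (Hx y L1 L2) as [N G]. rewrite ltS; intros [L| ->]; auto.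
    + intros m; destruct (IH m) as [x Hx]; exists x; intros y L1 L2 l.
      rewrite ltS; intros [L| ->]; [apply Hx; auto|tauto].
Qed.

Lemma minimal_ultrafilters : partial_minimal_ultrafilters_exist M.
Proof.
  intros Z HZ Htr.
  destruct (maximal_thick Z) as (J & HJ & Hmax).
  (* In the limit these requirements put every translate of the complements of the [A_j], [j] in
     [J], into [F]. *)
  set (E := fun m x => forall j, j < m -> j ∈ J ->
    forall n, n <= m -> ~ at_index Z j (x + n)).
  destruct (@ultrafilter_branch Z E) as [F HF].
  - unfold E; definable.
  - intros m m' x L H j Lj Hj n Ln; apply H; eauto using lt_le_trans, le_trans.
  (* Starting at [x + m] makes the point at least [m]; its translates by at most [m] stay within
     length [m + m] of [x]. *)
  - intros m; destruct (HJ m (m + m)) as [x Hx]; exists (x + m); split; [apply le_addl|].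
    intros j Lj Hj n Ln; apply Hx; auto.
    + rewrite <- addA; apply le_addr.
    + rewrite <- addA; apply le_add; auto. apply le_add; auto.
  - exists F; constructor.
    { apply branch_ultrafilter; auto.
      intros n; destruct (HF n n) as (x & L & _ & G); eauto. }
    intros i Hi.
    assert (NJ : ~ i ∈ J).
    { intros H. destruct (HF (i + 1) (i + 1)) as (x & _ & Ex & G).
      assert (L : i < i + 1) by (apply ltS; auto).
      apply (Ex i L H 0 (le0 _)). rewrite add0; apply G; auto. }
    (* By maximality thickness fails at some length [m], and this [m] is the syndeticity bound. *)
    assert (NT := fun H => NJ (Hmax i H)).
    apply not_all_ex_not in NT; destruct NT as [m NT].
    exists m; intros x. apply NNPP; intros N.
    (* One bound on indices of the translates of [A_i] by the numbers from [x] to [x + m] lets a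
       single point [z] decide all of them. *)
    destruct (@collection (x + m + 1) (fun k n => x <= n ->
      forall y, at_index Z k y <-> at_index Z i (y + n))) as [w Hw].
    { definable. }
    { intros n _; destruct (Htr i n) as [k Hk]; exists k; auto. }
    destruct (bound3 w (x + m) i) as (t & Lw & Lxm & Li).
    destruct (HF t t) as (z & _ & Ez & G).
    (* The interval of length [m] from [z + x] misses [A_i], since no translate of [A_i] considered
       is in [F], and misses the [A_j] by [Ez]. This contradicts the choice of [m]. *)
    apply NT; exists (z + x); intros y L1 L2.
    apply le_ex in L1; destruct L1 as [d ->].
    assert (Ld : x + d <= x + m).
    { destruct (lt_or_le (x + m) (x + d)) as [L|L]; auto. exfalso.
      apply (le_lt_absurd L2). rewrite <- !addA, (addC z), (addC z).
      apply lt_add2r; auto. }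
    rewrite <- addA. split.
    + intros Hy. destruct (Hw (x + d)) as (k & Lk & Hk); [apply ltS; auto|].
      specialize (Hk (le_addr x d)).
      apply N; exists (x + d); split; [|split; auto using le_addr].
      exists k; split; auto. apply G; [|apply Hk; auto].
      eapply le_lt_trans; eauto.
    + intros l Ll Hl; apply (Ez l); auto; [eapply lt_trans; eauto|].
      left; eapply le_lt_trans; eauto.
Qed.
End Ultrafilters.
End Model.

Theorem theorem9 (M : L2_structure) (hM : RCA0 M) :
  (partial_nonprincipal_ultrafilters_exist M <->
     partial_minimal_ultrafilters_exist M) /\
  (partial_minimal_ultrafilters_exist M <-> arithmetical_comprehension M).
Proof.
  (* Without any sets all schemes and all statements hold vacuously. *)
  destruct (classic (inhabited (set M))) as [[X0]|N].
  - rewrite (arithmetical_comprehensionP hM X0).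
    assert (H1 : partial_nonprincipal_ultrafilters_exist M -> projections_exist M).
    { intros H; apply (projections_of_ultrafilters hM X0); auto. }
    assert (H2 : partial_minimal_ultrafilters_exist M -> projections_exist M).
    { intros H; apply (projections_of_ultrafilters hM X0).
      intros Z HZ Htr; destruct (H Z HZ Htr) as [F [HF _]]; eauto. }
    pose proof (nonprincipal_ultrafilters hM X0).
    pose proof (minimal_ultrafilters hM X0). tauto.
  - assert (E : forall X : set M, False) by (intros X; apply N; constructor; auto).
    split; split; intros _.
    + intros Z; destruct (E Z).
    + intros Z; destruct (E Z).
    + intros p e v; destruct (E (v O)).
    + intros Z; destruct (E Z).
Qed.
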